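(* Let $u\in H^\infty+C$ be unimodular and let $p$ be a real polynomial with positive leading coefficient satisfying $p(-x)=-p(x)$. Then $e^{ip}u$ is not invertible in $H^\infty+C$, i.e. $e^{-ip}\bar u\notin H^\infty+C$.
   Context: $H^\infty$: bounded analytic functions in the upper half-plane, identified with boundary values on $\mathbb R$; $C$: continuous functions on $\mathbb R$ with finite limits at $\pm\infty$ that coincide; $H^\infty+C=\{h+g:h\in H^\infty,g\in C\}$, a closed subalgebra of $L^\infty(\mathbb R)$. A function $f\in H^\infty+C$ is invertible in $H^\infty+C$ if $1/f\in H^\infty+C$. *)

(* Defs.v *)
From Stdlib Require Import Reals List.
Open Scope R_scope.

Definition Cx : Type := (R * R)%type.
Definition Cadd (z w : Cx) : Cx := (fst z + fst w, snd z + snd w).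
Definition Csub (z w : Cx) : Cx := (fst z - fst w, snd z - snd w).
Definition Cmul (z w : Cx) : Cx :=
  (fst z * fst w - snd z * snd w, fst z * snd w + snd z * fst w).
Definition Cconj (z : Cx) : Cx := (fst z, - snd z).
Definition Cnorm (z : Cx) : R := sqrt (fst z * fst z + snd z * snd z).
Definition Cexpi (t : R) : Cx := (cos t, sin t).

Definition null_set (N : R -> Prop) : Prop :=
  forall eps, eps > 0 ->
    exists a b : nat -> R,
      (forall n, a n <= b n) /\
      (forall x, N x -> exists n, a n < x < b n) /\
      (forall n, sum_f_R0 (fun k => b k - a k) n <= eps).

Definition ae (P : R -> Prop) : Prop :=
  exists N, null_set N /\ forall x, ~ N x -> P x.

Definition holo_UHP (F : Cx -> Cx) : Prop :=
  forall z : Cx, 0 < snd z ->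
    exists L : Cx, forall eps, eps > 0 ->
      exists delta, delta > 0 /\
        forall h : Cx, h <> (0, 0) -> Cnorm h < delta ->
          Cnorm (Csub (Csub (F (Cadd z h)) (F z)) (Cmul L h)) <= eps * Cnorm h.

Definition Hinf (h : R -> Cx) : Prop :=
  exists F : Cx -> Cx,
    holo_UHP F /\
    (exists M, forall z : Cx, 0 < snd z -> Cnorm (F z) <= M) /\
    ae (fun x => forall eps, eps > 0 ->
          exists d, d > 0 /\ forall y, 0 < y < d ->
            Cnorm (Csub (F (x, y)) (h x)) < eps).

Definition Cinf (g : R -> Cx) : Prop :=
  (forall x, continuity_pt (fun t => fst (g t)) x /\
             continuity_pt (fun t => snd (g t)) x) /\
  exists L : Cx,
    (forall eps, eps > 0 -> exists A, forall x, x > A -> Cnorm (Csub (g x) L) < eps) /\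
    (forall eps, eps > 0 -> exists A, forall x, x < A -> Cnorm (Csub (g x) L) < eps).

Definition HinfC (f : R -> Cx) : Prop :=
  exists h g, Hinf h /\ Cinf g /\ ae (fun x => f x = Cadd (h x) (g x)).

(* ---------- real polynomials as coefficient lists [a0; a1; ...; an] ---------- *)
Definition peval (p : list R) (x : R) : R :=
  fold_right (fun a acc => a + x * acc) 0 p.
Definition lead (p : list R) : R := last p 0.

(* Main.v *)
(** Near [+oo] the continuous parts of [u] and of [v = e^{-ip} conj u] are almost constant, so there
    [u] and [v] are uniformly close to boundary values of bounded analytic functions [H1] and [H2], and
    [G = H1 H2 e^{ip}] has boundary values close to [u v e^{ip} = 1]. On the other hand [Im p (x + i y)
    >= c y] for [0 <= y <= Y] and [x] large, so [G] is bounded there by [M], and is small at height [Y]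
    once [Y] is large. Integrating [G] around the rectangle with horizontal sides of length [T] at
    heights [eta -> 0] and [Y], Cauchy's theorem gives about [T] for the bottom, at most [T/8] for
    the top and at most [2 M Y] for the two vertical sides, which is absurd for large [T]. *)

From Stdlib Require Import Reals List Lra Lia Classical IndefiniteDescription.
From Coquelicot Require Import Coquelicot.
Require Import Defs.
Open Scope R_scope.

(** * Cauchy's theorem for rectangles *)

(** A function in [Hinf] has boundary values only almost everywhere, along vertical lines, so the
    lower side of the contour cannot be put on the real axis. It stays at positive heights, and the
    limit is taken by a bounded convergence theorem for Riemann integrals of continuous functions,
    with an exceptional set that is null in the sense of interval covers. The same bisection
    principle yields this theorem and Goursat's theorem, the latter because [holo_UHP] gives a
    complex derivative without its continuity. The height [Y] depends on the decay rate [c], so the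
    lower bound on [Im p] must come with a [c] that is independent of [Y]. Oddness excludes constant
    [p]; for those the conclusion fails already with [u = 1]. *)

Lemma nested_intervals (l u : nat -> R) :
  (forall n, l n <= l (S n)) -> (forall n, u (S n) <= u n) ->
  (forall n, l n <= u n) -> exists X, forall n, l n <= X <= u n.
Proof.
  intros Hl Hu Hlu.
  assert (Ml : forall n k, l n <= l (n + k)%nat).
  { intros n k; induction k as [|k IH].
    - rewrite Nat.add_0_r; lra.
    - rewrite Nat.add_succ_r; generalize (Hl (n + k)%nat); lra. }
  assert (Mu : forall n k, u (n + k)%nat <= u n).
  { intros n k; induction k as [|k IH].
    - rewrite Nat.add_0_r; lra.
    - rewrite Nat.add_succ_r; generalize (Hu (n + k)%nat); lra. }
  assert (Hlum : forall n m, l m <= u n).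
  { intros n m; apply Rle_trans with (l (m + n)%nat); [apply Ml|].
    apply Rle_trans with (u (m + n)%nat); [apply Hlu|].
    rewrite Nat.add_comm; apply Mu. }
  destruct (completeness (fun z => exists n, z = l n)) as [X [HX1 HX2]].
  - exists (u 0%nat); intros z [n ->]; apply Hlum.
  - exists (l 0%nat); now exists 0%nat.
  - exists X; intros n; split.
    + apply HX1; now exists n.
    + apply HX2; intros z [m ->]; apply Hlum.
Qed.

(* Cousin's lemma for rectangles: [P x y r] speaks about the rectangle
   [x, x + r w] * [y, y + r h], so that the aspect ratio is kept. *)
Lemma rectangle_bisection (P : R -> R -> R -> Prop) (a b w h : R) :
  0 <= w -> 0 <= h ->
  (forall x y r, 0 < r -> P x y (r / 2) -> P (x + r / 2 * w) y (r / 2) ->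
     P x (y + r / 2 * h) (r / 2) -> P (x + r / 2 * w) (y + r / 2 * h) (r / 2) ->
     P x y r) ->
  (forall X Y, a <= X <= a + w -> b <= Y <= b + h ->
     exists delta, 0 < delta /\ forall x y r, 0 < r < delta ->
       a <= x -> x <= X <= x + r * w -> x + r * w <= a + w ->
       b <= y -> y <= Y <= y + r * h -> y + r * h <= b + h -> P x y r) ->
  P a b 1.
Proof.
  intros Hw Hh Hsplit Hloc.
  apply NNPP; intros HN.
  (* The clauses are conditional so that [step] is total and can be iterated. On a bad rectangle it
     selects a bad quarter, which exists because four good quarters would contradict [Hsplit]. *)
  destruct (functional_choice (fun c c' : R * R * R =>
    let '(x, y, r) := c in let '(x', y', r') := c' in
    0 < r -> ~ P x y r ->
    ~ P x' y' r' /\ r' = r / 2 /\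
    x <= x' /\ x' + r' * w <= x + r * w /\ y <= y' /\ y' + r' * h <= y + r * h))
    as [step Hstep].
  { intros [[x y] r].
    destruct (classic (0 < r)) as [Hr|Hr]; [|exists (x, y, r); tauto].
    assert (0 <= r / 2 * w) by (apply Rmult_le_pos; lra).
    assert (0 <= r / 2 * h) by (apply Rmult_le_pos; lra).
    destruct (classic (P x y (r / 2))) as [H1|H1];
      [|exists (x, y, r / 2); repeat split; auto; lra].
    destruct (classic (P (x + r / 2 * w) y (r / 2))) as [H2|H2];
      [|exists (x + r / 2 * w, y, r / 2); repeat split; auto; lra].
    destruct (classic (P x (y + r / 2 * h) (r / 2))) as [H3|H3];
      [|exists (x, y + r / 2 * h, r / 2); repeat split; auto; lra].
    exists (x + r / 2 * w, y + r / 2 * h, r / 2); intros _ HP.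
    repeat split; try lra.
    intros H4; apply HP; apply Hsplit; auto. }
  pose (s := fix s n := match n with O => (a, b, 1) | S n => step (s n) end).
  pose (x n := fst (fst (s n))); pose (y n := snd (fst (s n)));
    pose (r n := snd (s n)).
  assert (Hs : forall n, s n = (x n, y n, r n)).
  { intros n; unfold x, y, r; destruct (s n) as [[? ?] ?]; reflexivity. }
  assert (Inv : forall n, 0 < r n /\ ~ P (x n) (y n) (r n)).
  { induction n as [|n [IH1 IH2]].
    - split; [unfold r; simpl; lra | exact HN].
    - generalize (Hstep (s n)); rewrite (Hs n); simpl.
      assert (E : step (x n, y n, r n) = s (S n)) by (rewrite <- Hs; reflexivity).
      rewrite E, Hs; intros H; destruct (H IH1 IH2) as [H1 [H2 _]].
      split; [lra | exact H1]. }
  assert (Next : forall n, r (S n) = r n / 2 /\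
    x n <= x (S n) /\ x (S n) + r (S n) * w <= x n + r n * w /\
    y n <= y (S n) /\ y (S n) + r (S n) * h <= y n + r n * h).
  { intros n; generalize (Hstep (s n)); rewrite (Hs n); simpl.
    assert (E : step (x n, y n, r n) = s (S n)) by (rewrite <- Hs; reflexivity).
    rewrite E, Hs; intros H; apply H; apply Inv. }
  assert (Hrw : forall n, 0 <= r n * w).
  { intros n; apply Rmult_le_pos; auto; left; apply Inv. }
  assert (Hrh : forall n, 0 <= r n * h).
  { intros n; apply Rmult_le_pos; auto; left; apply Inv. }
  destruct (nested_intervals x (fun n => x n + r n * w)) as [X HX];
    [intros n; apply Next | intros n; apply Next | intros n; generalize (Hrw n); lra |].
  destruct (nested_intervals y (fun n => y n + r n * h)) as [Y HY];
    [intros n; apply Next | intros n; apply Next | intros n; generalize (Hrh n); lra |].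
  assert (Hin : forall n, a <= x n /\ x n + r n * w <= a + w /\
                          b <= y n /\ y n + r n * h <= b + h).
  { induction n as [|n IH].
    - unfold x, y, r; simpl; lra.
    - generalize (Next n); lra. }
  destruct (Hloc X Y) as [delta [Hd HP]].
  { generalize (HX 0%nat); unfold x, r; simpl; lra. }
  { generalize (HY 0%nat); unfold y, r; simpl; lra. }
  assert (Hr : forall n, r n = (1 / 2) ^ n).
  { induction n as [|n IH]; [reflexivity|].
    rewrite (proj1 (Next n)), IH; simpl; lra. }
  destruct (pow_lt_1_zero (1 / 2)) with (y := delta) as [N HNn];
    [rewrite Rabs_pos_eq; lra | exact Hd |].
  specialize (HNn N (Nat.le_refl N)).
  assert (0 < r N) by apply Inv.
  rewrite <- Hr, Rabs_pos_eq in HNn by lra.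
  apply (proj2 (Inv N)), HP; try apply Hin; try apply HX; try apply HY; lra.
Qed.

Lemma differentiable_continuous_fst f x y a b :
  differentiable_pt_lim f x y a b -> continuous (fun t => f t y) x.
Proof.
  intros H; apply continuity_pt_filterlim, derivable_continuous_pt.
  exists (a * 1 + b * 0).
  apply (derivable_pt_lim_comp_2d f (fun t => t) (fun _ => y)); auto.
  apply derivable_pt_lim_id. apply derivable_pt_lim_const.
Qed.

Lemma differentiable_continuous_snd f x y a b :
  differentiable_pt_lim f x y a b -> continuous (fun t => f x t) y.
Proof.
  intros H; apply continuity_pt_filterlim, derivable_continuous_pt.
  exists (a * 0 + b * 1).
  apply (derivable_pt_lim_comp_2d f (fun _ => x) (fun t => t)); auto.
  apply derivable_pt_lim_const. apply derivable_pt_lim_id.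
Qed.

Lemma ex_RInt_cont (f : R -> R) (a b : R) :
  a <= b -> (forall x, a <= x <= b -> continuous f x) -> ex_RInt f a b.
Proof.
  intros Hab H; apply (ex_RInt_continuous (V := R_CompleteNormedModule)).
  intros z; rewrite Rmin_left, Rmax_right by exact Hab; apply H.
Qed.

(* Real part of the contour integral of [U + i V] around [a,b] * [c,d]. *)
Definition circulation (U V : R -> R -> R) (a b c d : R) : R :=
  RInt (fun x => U x c) a b - RInt (fun x => U x d) a b
  - RInt (fun y => V b y) c d + RInt (fun y => V a y) c d.

Section Goursat.

Variables (U V : R -> R -> R) (a b w h : R).
Hypothesis (Hw : 0 < w) (Hh : 0 < h).
Hypothesis Hdiff : forall x y, a <= x <= a + w -> b <= y <= b + h ->
  exists p q t, differentiable_pt_lim U x y p q /\ differentiable_pt_lim V x y (- q) t.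

Lemma ex_RInt_horizontal x1 x2 y : a <= x1 -> x1 <= x2 -> x2 <= a + w -> b <= y <= b + h ->
  ex_RInt (fun x => U x y) x1 x2.
Proof.
  intros; apply ex_RInt_cont; auto; intros x Hx.
  destruct (Hdiff x y) as (p & q & t & H3 & H4); try lra.
  eapply differentiable_continuous_fst; eauto.
Qed.

Lemma ex_RInt_vertical y1 y2 x : b <= y1 -> y1 <= y2 -> y2 <= b + h -> a <= x <= a + w ->
  ex_RInt (fun y => V x y) y1 y2.
Proof.
  intros; apply ex_RInt_cont; auto; intros y Hy.
  destruct (Hdiff x y) as (p & q & t & H3 & H4); try lra.
  eapply differentiable_continuous_snd; eauto.
Qed.

(** Each inner side is traversed twice, in opposite directions. *)
Lemma circulation_split x1 x2 x3 y1 y2 y3 :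
  a <= x1 -> x1 <= x2 -> x2 <= x3 -> x3 <= a + w ->
  b <= y1 -> y1 <= y2 -> y2 <= y3 -> y3 <= b + h ->
  circulation U V x1 x3 y1 y3 =
  circulation U V x1 x2 y1 y2 + circulation U V x2 x3 y1 y2 +
  circulation U V x1 x2 y2 y3 + circulation U V x2 x3 y2 y3.
Proof.
  intros; unfold circulation.
  assert (CU : forall y, b <= y <= b + h -> RInt (fun x => U x y) x1 x3 =
    RInt (fun x => U x y) x1 x2 + RInt (fun x => U x y) x2 x3).
  { intros y Hy; symmetry; apply (RInt_Chasles (V := R_CompleteNormedModule)); apply ex_RInt_horizontal; lra. }
  assert (CV : forall x, a <= x <= a + w -> RInt (fun y => V x y) y1 y3 =
    RInt (fun y => V x y) y1 y2 + RInt (fun y => V x y) y2 y3).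
  { intros x Hx; symmetry; apply (RInt_Chasles (V := R_CompleteNormedModule)); apply ex_RInt_vertical; lra. }
  rewrite !CU, !CV by lra; ring.
Qed.

(* The linear part of [U], [V] contributes [q (c-d) (b-a) + q (b-a) (d-c) = 0]. *)
Lemma circulation_local X Y p q t eps x1 x2 y1 y2 :
  a <= x1 -> x1 <= X <= x2 -> x2 <= a + w -> b <= y1 -> y1 <= Y <= y2 -> y2 <= b + h ->
  0 <= eps ->
  (forall x y, x1 <= x <= x2 -> y1 <= y <= y2 ->
    Rabs (U x y - U X Y - (p * (x - X) + q * (y - Y))) <= eps * ((x2 - x1) + (y2 - y1))) ->
  (forall x y, x1 <= x <= x2 -> y1 <= y <= y2 ->
    Rabs (V x y - V X Y - (- q * (x - X) + t * (y - Y))) <= eps * ((x2 - x1) + (y2 - y1))) ->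
  Rabs (circulation U V x1 x2 y1 y2) <= 2 * eps * ((x2 - x1) + (y2 - y1)) ^ 2.
Proof.
  intros A1 A2 A3 B1 B2 B3 He HU HV.
  set (D := (x2 - x1) + (y2 - y1)) in *.
  (* Opposite sides are paired. In the difference of the two linear approximations the value at
     [(X, Y)] and the term along the side cancel, so [f] and [g] are bounded by [2 * eps * D]. *)
  pose (f := fun x => U x y1 - U x y2 - q * (y1 - y2)).
  pose (g := fun y => V x2 y - V x1 y + q * (x2 - x1)).
  assert (EU : forall y, y1 <= y <= y2 -> ex_RInt (fun x => U x y) x1 x2)
    by (intros; apply ex_RInt_horizontal; lra).
  assert (EV : forall x, x1 <= x <= x2 -> ex_RInt (fun y => V x y) y1 y2)
    by (intros; apply ex_RInt_vertical; lra).
  assert (If : is_RInt f x1 x2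
    (RInt (fun x => U x y1) x1 x2 - RInt (fun x => U x y2) x1 x2 - (x2 - x1) * (q * (y1 - y2)))).
  { apply (is_RInt_minus (V := R_NormedModule) (fun x => U x y1 - U x y2) (fun _ => q * (y1 - y2))).
    - apply (is_RInt_minus (V := R_NormedModule) (fun x => U x y1) (fun x => U x y2));
      apply (RInt_correct (V := R_CompleteNormedModule)), EU; lra.
    - apply (is_RInt_const (V := R_NormedModule)). }
  assert (Ig : is_RInt g y1 y2
    (RInt (fun y => V x2 y) y1 y2 - RInt (fun y => V x1 y) y1 y2 + (y2 - y1) * (q * (x2 - x1)))).
  { apply (is_RInt_plus (V := R_NormedModule) (fun y => V x2 y - V x1 y) (fun _ => q * (x2 - x1))).
    - apply (is_RInt_minus (V := R_NormedModule) (fun y => V x2 y) (fun y => V x1 y));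
      apply (RInt_correct (V := R_CompleteNormedModule)), EV; lra.
    - apply (is_RInt_const (V := R_NormedModule)). }
  apply (norm_RInt_le_const (V := R_NormedModule)) with (M := 2 * eps * D) in If.
  apply (norm_RInt_le_const (V := R_NormedModule)) with (M := 2 * eps * D) in Ig.
  - replace (circulation U V x1 x2 y1 y2) with
     ((RInt (fun x => U x y1) x1 x2 - RInt (fun x => U x y2) x1 x2 - (x2 - x1) * (q * (y1 - y2)))
     - (RInt (fun y => V x2 y) y1 y2 - RInt (fun y => V x1 y) y1 y2 + (y2 - y1) * (q * (x2 - x1))))
     by (unfold circulation; ring).
    eapply Rle_trans; [apply Rabs_triang|]; rewrite Rabs_Ropp.
    eapply Rle_trans; [apply Rplus_le_compat; [exact If | exact Ig] |].
    unfold D; right; ring.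
  - lra.
  - intros y Hy.
    assert (H1 := HV x2 y ltac:(lra) Hy); assert (H2 := HV x1 y ltac:(lra) Hy).
    apply Rabs_le_between in H1; apply Rabs_le_between in H2.
    apply Rabs_le_between; unfold g; lra.
  - lra.
  - intros x Hx.
    assert (H1 := HU x y1 Hx ltac:(lra)); assert (H2 := HU x y2 Hx ltac:(lra)).
    apply Rabs_le_between in H1; apply Rabs_le_between in H2.
    apply Rabs_le_between; unfold f; lra.
Qed.

(* Goursat's bisection argument; of the Cauchy-Riemann equations only [U_y = - V_x] is needed. *)
Lemma goursat : circulation U V a (a + w) b (b + h) = 0.
Proof.
  assert (K : forall kappa, 0 < kappa ->
    Rabs (circulation U V a (a + w) b (b + h)) <= kappa).
  2:{ destruct (Req_dec (circulation U V a (a + w) b (b + h)) 0) as [E|E]; auto.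
      assert (P := Rabs_pos_lt _ E).
      specialize (K (Rabs (circulation U V a (a + w) b (b + h)) / 2) ltac:(lra)); lra. }
  intros kappa Hk.
  (* The bound [kappa * r ^ 2] is proportional to area, hence exactly additive over four quarters.
     Containment in the big rectangle is part of the predicate, since integrability is known only
     there. *)
  cut (a <= a -> a + 1 * w <= a + w -> b <= b -> b + 1 * h <= b + h ->
       Rabs (circulation U V a (a + 1 * w) b (b + 1 * h)) <= kappa * 1 ^ 2).
  { rewrite !Rmult_1_l; simpl; intros H; generalize (H ltac:(lra) ltac:(lra) ltac:(lra) ltac:(lra)); lra. }
  apply (rectangle_bisection (fun x y r =>
    a <= x -> x + r * w <= a + w -> b <= y -> y + r * h <= b + h ->
    Rabs (circulation U V x (x + r * w) y (y + r * h)) <= kappa * r ^ 2) a b w h); try lra.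
  - intros x y r Hr P1 P2 P3 P4 A1 A2 B1 B2.
    assert (0 <= r / 2 * w) by (apply Rmult_le_pos; lra).
    assert (0 <= r / 2 * h) by (apply Rmult_le_pos; lra).
    rewrite (circulation_split x (x + r / 2 * w) _ y (y + r / 2 * h)) by lra.
    specialize (P1 ltac:(lra) ltac:(lra) ltac:(lra) ltac:(lra)).
    specialize (P2 ltac:(lra) ltac:(lra) ltac:(lra) ltac:(lra)).
    specialize (P3 ltac:(lra) ltac:(lra) ltac:(lra) ltac:(lra)).
    specialize (P4 ltac:(lra) ltac:(lra) ltac:(lra) ltac:(lra)).
    replace (x + r / 2 * w + r / 2 * w) with (x + r * w) in P2, P4 by field.
    replace (y + r / 2 * h + r / 2 * h) with (y + r * h) in P3, P4 by field.
    replace (kappa * r ^ 2) with (kappa * (r / 2) ^ 2 + kappa * (r / 2) ^ 2 +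
      kappa * (r / 2) ^ 2 + kappa * (r / 2) ^ 2) by field.
    apply Rabs_le_between in P1; apply Rabs_le_between in P2;
    apply Rabs_le_between in P3; apply Rabs_le_between in P4.
    apply Rabs_le_between; lra.
  - intros X Y HX HY.
    destruct (Hdiff X Y HX HY) as (p & q & t & DU & DV).
    (* This tolerance turns the bound [2 * eps * (r * w + r * h) ^ 2] of [circulation_local] into
       [kappa * r ^ 2]. *)
    assert (He : 0 < kappa / (2 * (w + h) ^ 2)).
    { apply Rdiv_lt_0_compat; auto; apply Rmult_lt_0_compat; [lra | apply pow_lt; lra]. }
    destruct (DU (mkposreal _ He)) as [d1 H1]; destruct (DV (mkposreal _ He)) as [d2 H2].
    simpl in H1, H2; set (eps := kappa / (2 * (w + h) ^ 2)) in *.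
    assert (Hd : 0 < Rmin d1 d2) by (apply Rmin_glb_lt; [apply d1 | apply d2]).
    exists (Rmin d1 d2 / (w + h)); split; [apply Rdiv_lt_0_compat; lra |].
    intros x y r [Hr0 Hr] A1 A2 A3 B1 B2 B3 _ _ _ _.
    assert (Hrd : r * (w + h) < Rmin d1 d2).
    { apply Rmult_lt_compat_r with (r := w + h) in Hr; [|lra].
      unfold Rdiv in Hr; rewrite Rmult_assoc, Rinv_l in Hr; lra. }
    assert (L1 := Rmin_l d1 d2); assert (L2 := Rmin_r d1 d2).
    assert (0 < r * w) by (apply Rmult_lt_0_compat; lra).
    assert (0 < r * h) by (apply Rmult_lt_0_compat; lra).
    assert (Est : forall x' y', x <= x' <= x + r * w -> y <= y' <= y + r * h ->
       Rabs (x' - X) < Rmin d1 d2 /\ Rabs (y' - Y) < Rmin d1 d2 /\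
       eps * Rmax (Rabs (x' - X)) (Rabs (y' - Y)) <=
       eps * (x + r * w - x + (y + r * h - y))).
    { intros x' y' Hx' Hy'.
      assert (Rabs (x' - X) <= r * w) by (apply Rabs_le_between; lra).
      assert (Rabs (y' - Y) <= r * h) by (apply Rabs_le_between; lra).
      repeat split; try lra.
      apply Rmult_le_compat_l; [lra|]; apply Rmax_lub; lra. }
    eapply Rle_trans; [apply (circulation_local X Y p q t eps); try lra|].
    + intros x' y' Hx' Hy'; destruct (Est x' y' Hx' Hy') as (E1 & E2 & E3).
      eapply Rle_trans; [apply H1; lra | exact E3].
    + intros x' y' Hx' Hy'; destruct (Est x' y' Hx' Hy') as (E1 & E2 & E3).
      eapply Rle_trans; [apply H2; lra | exact E3].
    + right; unfold eps; field; lra.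
Qed.

End Goursat.

(** * Bounded convergence for Riemann integrals *)

(** The length of the intersection of the intervals from [a] to [b] and from [s] to [t]. *)
Definition overlap (a b s t : R) : R := Rmax 0 (Rmin b t - Rmax a s).

Lemma overlap_pos a b s t : 0 <= overlap a b s t.
Proof. apply Rmax_l. Qed.

Lemma overlap_le a b s t : a <= b -> overlap a b s t <= b - a.
Proof.
  intros H; apply Rmax_lub; [lra|].
  generalize (Rmin_l b t) (Rmax_l a s); lra.
Qed.

Lemma overlap_split a b s m t : s <= m -> m <= t ->
  overlap a b s t = overlap a b s m + overlap a b m t.
Proof.
  intros H1 H2; unfold overlap, Rmax, Rmin.
  destruct (Rle_dec b t), (Rle_dec b m), (Rle_dec a s), (Rle_dec a m);
    repeat match goal with |- context [Rle_dec ?x ?y] => destruct (Rle_dec x y) end; lra.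
Qed.

Lemma overlap_inside a b s t : a <= s -> s <= t -> t <= b -> overlap a b s t = t - s.
Proof.
  intros; unfold overlap; rewrite (Rmin_right b t), (Rmax_right a s), Rmax_right; lra.
Qed.

Lemma sum_f_R0_mono (f : nat -> R) (n m : nat) :
  (forall k, 0 <= f k) -> (n <= m)%nat -> sum_f_R0 f n <= sum_f_R0 f m.
Proof.
  intros Hf; induction 1 as [|m _ IH]; [lra|].
  simpl; generalize (Hf (S m)); lra.
Qed.

Lemma term_le_sum (f : nat -> R) (n : nat) :
  (forall k, 0 <= f k) -> f n <= sum_f_R0 f n.
Proof.
  intros Hf; destruct n as [|n]; simpl; [lra|].
  generalize (cond_pos_sum f n Hf); lra.
Qed.

Lemma RInt_le_cont (f g : R -> R) (a b : R) : a <= b ->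
  (forall x, continuous f x) -> (forall x, continuous g x) ->
  (forall x, a <= x <= b -> f x <= g x) -> RInt f a b <= RInt g a b.
Proof.
  intros Hab Cf Cg H; apply RInt_le; auto; try (apply ex_RInt_cont; auto).
  intros x Hx; apply H; lra.
Qed.

Lemma RInt_le_const (f : R -> R) (a b C : R) : a <= b ->
  (forall x, continuous f x) -> (forall x, a <= x <= b -> f x <= C) ->
  RInt f a b <= C * (b - a).
Proof.
  intros Hab Cf H.
  replace (C * (b - a)) with (RInt (fun _ => C) a b)
    by (rewrite RInt_const; unfold scal; simpl; unfold mult; simpl; ring).
  apply RInt_le_cont; auto; intros; apply continuous_const.
Qed.

(** A Cousin argument. Near a point of [N], a small interval lies inside one covering interval and
    the crude bound [C] is charged to its overlap. Near any other point some [h n] is below [eps] on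
    a whole neighbourhood, by continuity. Monotonicity in [n] lets finitely many such pieces share
    one index. *)
Lemma decreasing_integral_null (h : nat -> R -> R) (a b C eps eta : R) (N : R -> Prop) :
  a <= b -> 0 <= C -> 0 <= eps -> 0 < eta ->
  (forall n x, continuous (h n) x) ->
  (forall n x, a <= x <= b -> h (S n) x <= h n x) ->
  (forall n x, a <= x <= b -> h n x <= C) ->
  null_set N ->
  (forall x, a <= x <= b -> ~ N x -> exists n, h n x < eps) ->
  exists n, RInt (h n) a b <= eps * (b - a) + eta.
Proof.
  intros Hab HC He Heta Hcont Hdec Hbd HN Hlim.
  (* Dividing by [C + 1] rather than [C] allows [C = 0]. *)
  destruct (HN (eta / (C + 1))) as (al & be & Hle & Hcov & Hsum);
    [apply Rdiv_lt_0_compat; lra|].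
  (* [L s t K] measures how much of [[s, t]] the covering intervals up to index [K] take up, with
     multiplicity. It is additive in the interval, so the bound in [Q] passes from two halves to
     their union. *)
  pose (L := fun s t K => sum_f_R0 (fun k => overlap (al k) (be k) s t) K).
  pose (Q := fun s t => exists n K, RInt (h n) s t <= eps * (t - s) + C * L s t K).
  assert (Hdec' : forall n m x, (n <= m)%nat -> a <= x <= b -> h m x <= h n x).
  { intros n m x Hnm Hx; induction Hnm as [|m _ IH]; [lra|].
    generalize (Hdec m x Hx); lra. }
  assert (HQ : Q a b).
  { cut (a <= a -> a + 1 * (b - a) <= b -> Q a (a + 1 * (b - a))).
    { replace (a + 1 * (b - a)) with b by ring; intros H; apply H; lra. }
    (* An interval is treated as a rectangle of height 0; the vertical coordinate is ignored. *)
    apply (rectangle_bisection (fun x _ r => a <= x -> x + r * (b - a) <= b ->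
      Q x (x + r * (b - a))) a 0 (b - a) 0); try lra.
    - intros x y r Hr P1 P2 _ _ A1 A2.
      assert (0 <= r / 2 * (b - a)) by (apply Rmult_le_pos; lra).
      destruct (P1 ltac:(lra) ltac:(lra)) as (n1 & K1 & I1).
      destruct (P2 ltac:(lra) ltac:(lra)) as (n2 & K2 & I2).
      replace (x + r / 2 * (b - a) + r / 2 * (b - a)) with (x + r * (b - a)) in I2 by field.
      set (m := x + r / 2 * (b - a)) in *; set (t := x + r * (b - a)) in *.
      assert (Hm : x <= m <= t) by (unfold m, t; lra).
      (* A larger [n] lowers the integrals and a larger [K] raises the nonnegative overlap sums, so
         both halves accept the maxima. *)
      exists (max n1 n2), (max K1 K2).
      assert (J1 : RInt (h (max n1 n2)) x m <= RInt (h n1) x m).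
      { apply RInt_le_cont; auto; [lra|]; intros; apply Hdec'; [lia | lra]. }
      assert (J2 : RInt (h (max n1 n2)) m t <= RInt (h n2) m t).
      { apply RInt_le_cont; auto; [lra|]; intros; apply Hdec'; [lia | lra]. }
      rewrite <- (RInt_Chasles (V := R_CompleteNormedModule) _ x m t)
        by (apply ex_RInt_cont; auto; lra).
      unfold plus; simpl.
      assert (E : L x t (max K1 K2) = L x m (max K1 K2) + L m t (max K1 K2)).
      { unfold L; rewrite <- plus_sum; apply sum_eq; intros; apply overlap_split; lra. }
      assert (M1 : L x m K1 <= L x m (max K1 K2))
        by (apply sum_f_R0_mono; [intros; apply overlap_pos | lia]).
      assert (M2 : L m t K2 <= L m t (max K1 K2))
        by (apply sum_f_R0_mono; [intros; apply overlap_pos | lia]).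
      rewrite E.
      apply Rmult_le_compat_l with (r := C) in M1; [|exact HC].
      apply Rmult_le_compat_l with (r := C) in M2; [|exact HC].
      nra.
    - intros X Y HX _.
      destruct (classic (N X)) as [NX|NX].
      + destruct (Hcov X NX) as [k Hk].
        (* The interval around [X] then stays strictly inside the [k]-th covering interval; the
           added 1 avoids division by zero when [a = b]. *)
        exists (Rmin (X - al k) (be k - X) / (b - a + 1)).
        assert (Hm : 0 < Rmin (X - al k) (be k - X)) by (apply Rmin_glb_lt; lra).
        split; [apply Rdiv_lt_0_compat; lra|].
        intros x y r Hr A1 A2 A3 _ _ _ _ _.
        assert (Hrd : r * (b - a + 1) < Rmin (X - al k) (be k - X)).
        { apply Rlt_le_trans with (Rmin (X - al k) (be k - X) / (b - a + 1) * (b - a + 1)).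
          - apply Rmult_lt_compat_r; lra.
          - right; field; lra. }
        assert (L1 := Rmin_l (X - al k) (be k - X)); assert (L2 := Rmin_r (X - al k) (be k - X)).
        set (t := x + r * (b - a)) in *.
        assert (Ht : t = x + r * (b - a)) by reflexivity.
        exists 0%nat, k.
        assert (I : RInt (h 0%nat) x t <= C * (t - x)).
        { apply RInt_le_const; auto; [lra|]; intros; apply Hbd; lra. }
        assert (T := term_le_sum (fun k => overlap (al k) (be k) x t) k
          (fun k => overlap_pos _ _ _ _)).
        cbv beta in T; rewrite (overlap_inside (al k) (be k) x t) in T by lra.
        apply Rmult_le_compat_l with (r := C) in T; [|exact HC].
        assert (0 <= eps * (t - x)) by (apply Rmult_le_pos; lra).
        unfold L; lra.
      + destruct (Hlim X ltac:(lra) NX) as [n Hn].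
        assert (Hc := Hcont n X); apply continuity_pt_filterlim in Hc.
        destruct (Hc (eps - h n X)) as (d & Hd & Hc'); [lra|].
        exists (d / (b - a + 1)); split; [apply Rdiv_lt_0_compat; lra|].
        intros x y r Hr A1 A2 A3 _ _ _ _ _.
        assert (Hrd : r * (b - a + 1) < d).
        { apply Rlt_le_trans with (d / (b - a + 1) * (b - a + 1)).
          - apply Rmult_lt_compat_r; lra.
          - right; field; lra. }
        set (t := x + r * (b - a)) in *.
        assert (Ht : t = x + r * (b - a)) by reflexivity.
        exists n, 0%nat.
        assert (I : RInt (h n) x t <= eps * (t - x)).
        { apply RInt_le_const; auto; [lra|]; intros z Hz.
          destruct (Req_dec z X) as [->|Hzx]; [lra|].
          assert (J : R_dist (h n z) (h n X) < eps - h n X).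
          { apply Hc'; split; [split; [exact I | auto]|].
            simpl; unfold R_dist; apply Rabs_lt_between; lra. }
          unfold R_dist in J; apply Rabs_lt_between in J; lra. }
        assert (0 <= C * L x t 0%nat) by (apply Rmult_le_pos; auto; apply overlap_pos).
        lra. }
  destruct HQ as (n & K & HnK); exists n.
  assert (HL : L a b K <= eta / (C + 1)).
  { eapply Rle_trans; [|apply (Hsum K)].
    apply sum_Rle; intros; apply overlap_le, Hle. }
  apply Rmult_le_compat_l with (r := C) in HL; [|exact HC].
  assert (C * (eta / (C + 1)) <= eta).
  { replace eta with ((C + 1) * (eta / (C + 1))) at 2 by (field; lra).
    apply Rmult_le_compat_r; [left; apply Rdiv_lt_0_compat|]; lra. }
  lra.
Qed.

Lemma continuous_Rmax (f g : R -> R) (x : R) :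
  continuous f x -> continuous g x -> continuous (fun t => Rmax (f t) (g t)) x.
Proof.
  intros Hf Hg.
  apply continuous_ext with (fun t => / 2 * (f t + g t + Rabs (f t - g t))).
  { intros t; apply Rminus_diag_uniq; unfold Rmax; destruct (Rle_dec (f t) (g t));
    [rewrite Rabs_left1 by lra | rewrite Rabs_pos_eq by lra]; field. }
  apply (continuous_scal_r (K := R_AbsRing) (V := R_NormedModule)).
  apply (continuous_plus (V := R_NormedModule) (fun t => f t + g t) (fun t => Rabs (f t - g t))).
  - apply (continuous_plus (V := R_NormedModule)); auto.
  - apply (continuous_comp (fun t => f t - g t) Rabs); [|apply continuous_Rabs].
    apply (continuous_minus (V := R_NormedModule)); auto.
Qed.

Lemma continuous_Rmin (f g : R -> R) (x : R) :
  continuous f x -> continuous g x -> continuous (fun t => Rmin (f t) (g t)) x.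
Proof.
  intros Hf Hg.
  apply continuous_ext with (fun t => f t + g t - Rmax (f t) (g t)).
  { intros t; apply Rminus_diag_uniq; unfold Rmax, Rmin; destruct (Rle_dec (f t) (g t)); ring. }
  apply (continuous_minus (V := R_NormedModule) (fun t => f t + g t)).
  - apply (continuous_plus (V := R_NormedModule)); auto.
  - apply continuous_Rmax; auto.
Qed.

Fixpoint block_max (f : nat -> R -> R) (n k : nat) (x : R) : R :=
  match k with
  | O => f n x
  | S k => Rmax (block_max f n k x) (f (n + S k)%nat x)
  end.

Lemma block_max_continuous f n k x :
  (forall i x, continuous (f i) x) -> continuous (block_max f n k) x.
Proof.
  intros H; induction k as [|k IH]; [apply H|].
  apply continuous_Rmax; auto.
Qed.

Lemma block_max_ub f n k i x : (n <= i <= n + k)%nat -> f i x <= block_max f n k x.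
Proof.
  induction k as [|k IH]; intros Hi; simpl.
  - replace i with n by lia; lra.
  - destruct (Nat.eq_dec i (n + S k)) as [->|Hne]; [apply Rmax_r|].
    eapply Rle_trans; [apply IH; lia | apply Rmax_l].
Qed.

Lemma block_max_le f n k x M :
  (forall i, (n <= i <= n + k)%nat -> f i x <= M) -> block_max f n k x <= M.
Proof.
  induction k as [|k IH]; intros H; simpl; [apply H; lia|].
  apply Rmax_lub; [apply IH; intros; apply H; lia | apply H; lia].
Qed.

Lemma block_max_lt f n k x M :
  (forall i, (n <= i <= n + k)%nat -> f i x < M) -> block_max f n k x < M.
Proof.
  induction k as [|k IH]; intros H; simpl; [apply H; lia|].
  apply Rmax_lub_lt; [apply IH; intros; apply H; lia | apply H; lia].
Qed.

Fixpoint running_min (g : nat -> R -> R) (n : nat) (x : R) : R :=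
  match n with
  | O => g O x
  | S n => Rmin (running_min g n x) (g (S n) x)
  end.

Lemma running_min_continuous g n x :
  (forall i x, continuous (g i) x) -> continuous (running_min g n) x.
Proof.
  intros H; induction n as [|n IH]; [apply H|].
  apply continuous_Rmin; auto.
Qed.

Lemma running_min_le g n x : running_min g n x <= g n x.
Proof. destruct n; simpl; [lra | apply Rmin_r]. Qed.

Lemma RInt_min_max (f g : R -> R) (a b : R) : a <= b ->
  (forall x, continuous f x) -> (forall x, continuous g x) ->
  RInt (fun x => Rmin (f x) (g x)) a b =
  RInt f a b + RInt g a b - RInt (fun x => Rmax (f x) (g x)) a b.
Proof.
  intros Hab Cf Cg.
  assert (If := RInt_correct (V := R_CompleteNormedModule) f a b
    ltac:(apply ex_RInt_cont; auto)).
  assert (Ig := RInt_correct (V := R_CompleteNormedModule) g a b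
    ltac:(apply ex_RInt_cont; auto)).
  assert (Im := RInt_correct (V := R_CompleteNormedModule) (fun x => Rmax (f x) (g x)) a b
    ltac:(apply ex_RInt_cont; auto; intros; apply continuous_Rmax; auto)).
  apply is_RInt_unique.
  apply (is_RInt_ext (V := R_NormedModule) (fun x => f x + g x - Rmax (f x) (g x))).
  { intros x _; unfold Rmax, Rmin; destruct (Rle_dec (f x) (g x)); simpl; ring. }
  apply (is_RInt_minus (V := R_NormedModule) (fun x => f x + g x)); auto.
  apply (is_RInt_plus (V := R_NormedModule)); auto.
Qed.

(* Replacing [f] by nearly optimal maxima [g n] of blocks starting at [n] makes the running minima
   [h n] of the [g n] lose almost no integral, since [min + max] is the sum and [max (h n) (g (n+1))]
   is below a longer block from [n]. The [h n] decrease, so the monotone case applies. *)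
Lemma bounded_convergence_null (f : nat -> R -> R) (a b C eps eta : R) (N : R -> Prop) :
  a <= b -> 0 <= C -> 0 <= eps -> 0 < eta ->
  (forall n x, continuous (f n) x) ->
  (forall n x, a <= x <= b -> f n x <= C) ->
  null_set N ->
  (forall x, a <= x <= b -> ~ N x -> exists n, forall m, (n <= m)%nat -> f m x < eps) ->
  exists n, RInt (f n) a b <= eps * (b - a) + eta.
Proof.
  intros Hab HC He Heta Hcont Hbd HN Hlim.
  (* The losses [eta' * (1 / 2) ^ n] sum to at most [2 * eta'], and the decreasing case costs
     another [eta']. *)
  set (eta' := eta / 3).
  (* The integrals of block maxima starting at [n] are bounded by [C * (b - a)], so some block comes
     within the allowed loss of their supremum. *)
  assert (Hsup : forall n, exists k, forall k',
    RInt (block_max f n k') a b <= RInt (block_max f n k) a b + eta' * (1 / 2) ^ n).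
  { intros n.
    assert (Hpos : 0 < eta' * (1 / 2) ^ n).
    { apply Rmult_lt_0_compat; [unfold eta'; lra | apply pow_lt; lra]. }
    destruct (completeness (fun z => exists k, z = RInt (block_max f n k) a b)) as [S [S1 S2]].
    - exists (C * (b - a)); intros z [k ->].
      apply RInt_le_const; auto; intros; [apply block_max_continuous; auto|].
      apply block_max_le; intros; apply Hbd; auto.
    - exists (RInt (block_max f n 0%nat) a b); now exists 0%nat.
    - apply NNPP; intros HNN.
      assert (S <= S - eta' * (1 / 2) ^ n); [|lra].
      apply S2; intros z [k ->].
      apply Rnot_lt_le; intros Hlt; apply HNN; exists k; intros k'.
      assert (RInt (block_max f n k') a b <= S) by (apply S1; now exists k').
      lra. }
  destruct (functional_choice _ Hsup) as [k Hk].
  pose (g := fun n => block_max f n (k n)).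
  assert (Cg : forall n x, continuous (g n) x)
    by (intros; apply block_max_continuous; auto).
  assert (Ch : forall n x, continuous (running_min g n) x)
    by (intros; apply running_min_continuous; auto).
  assert (Hint : forall n, RInt (g n) a b - 2 * eta' * (1 - (1 / 2) ^ n) <=
                           RInt (running_min g n) a b).
  { induction n as [|n IH]; [change (running_min g 0%nat) with (g 0%nat); rewrite pow_O; lra|].
    change (running_min g (S n)) with (fun x => Rmin (running_min g n x) (g (S n) x)).
    rewrite RInt_min_max by auto.
    (* The block from [n] of this length ends where the block of [g (S n)] ends, and so contains the
       blocks of both [g n] and [g (S n)]. *)
    assert (RInt (fun x => Rmax (running_min g n x) (g (S n) x)) a b <=
            RInt (block_max f n (k n + S (k (S n)))) a b).
    { apply RInt_le_cont; auto.
      - intros; apply continuous_Rmax; auto.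
      - intros; apply block_max_continuous; auto.
      - intros x Hx; apply Rmax_lub.
        + eapply Rle_trans; [apply running_min_le|].
          apply block_max_le; intros; apply block_max_ub; lia.
        + apply block_max_le; intros; apply block_max_ub; lia. }
    generalize (Hk n (k n + S (k (S n)))%nat); fold (g n); simpl; lra. }
  destruct (decreasing_integral_null (running_min g) a b C eps eta' N) as [n Hn]; auto.
  - unfold eta'; lra.
  - intros; apply Rmin_l.
  - intros n x Hx; eapply Rle_trans; [apply running_min_le|].
    apply block_max_le; intros; apply Hbd; auto.
  - intros x Hx NX; destruct (Hlim x Hx NX) as [n Hn]; exists n.
    eapply Rle_lt_trans; [apply running_min_le|].
    apply block_max_lt; intros; apply Hn; lia.
  - exists n.
    assert (RInt (f n) a b <= RInt (g n) a b).
    { apply RInt_le_cont; auto; intros; apply block_max_ub; lia. }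
    assert (0 < eta' * (1 / 2) ^ n).
    { apply Rmult_lt_0_compat; [unfold eta'; lra | apply pow_lt; lra]. }
    generalize (Hint n); unfold eta' in *; lra.
Qed.

(** * Null sets and properties holding almost everywhere *)

Lemma null_set_union (N1 N2 : R -> Prop) :
  null_set N1 -> null_set N2 -> null_set (fun x => N1 x \/ N2 x).
Proof.
  intros H1 H2 eps He.
  destruct (H1 (eps / 2) ltac:(lra)) as (a1 & b1 & L1 & C1 & S1).
  destruct (H2 (eps / 2) ltac:(lra)) as (a2 & b2 & L2 & C2 & S2).
  (* The two covers are interleaved: the first takes the even indices, the second the odd ones. *)
  pose (mix := fun (c1 c2 : nat -> R) n =>
    if Nat.even n then c1 (Nat.div2 n) else c2 (Nat.div2 n)).
  assert (Ev : forall c1 c2 n, mix c1 c2 (2 * n)%nat = c1 n).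
  { intros; unfold mix; rewrite Nat.even_mul; simpl Nat.even; cbv iota beta.
    now rewrite Nat.div2_double. }
  assert (Od : forall c1 c2 n, mix c1 c2 (S (2 * n)) = c2 n).
  { intros; unfold mix. rewrite Nat.even_succ, Nat.odd_mul; simpl Nat.odd; cbv iota beta.
    now rewrite Nat.div2_succ_double. }
  assert (Pos : forall n, 0 <= mix b1 b2 n - mix a1 a2 n).
  { intros n; unfold mix; destruct (Nat.even n);
    [generalize (L1 (Nat.div2 n)) | generalize (L2 (Nat.div2 n))]; lra. }
  exists (mix a1 a2), (mix b1 b2); repeat split.
  - intros n; generalize (Pos n); lra.
  - intros x [Hx|Hx].
    + destruct (C1 x Hx) as [n Hn]; exists (2 * n)%nat; rewrite !Ev; exact Hn.
    + destruct (C2 x Hx) as [n Hn]; exists (S (2 * n)); rewrite !Od; exact Hn.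
  - intros n.
    (* Going up to the odd index [2 n + 1] completes the last pair, so the sum separates into two
       partial sums up to [n]. *)
    apply Rle_trans with (sum_f_R0 (fun k => mix b1 b2 k - mix a1 a2 k) (S (2 * n))).
    { apply sum_f_R0_mono; [exact Pos | lia]. }
    assert (E : forall n, sum_f_R0 (fun k => mix b1 b2 k - mix a1 a2 k) (S (2 * n)) =
      sum_f_R0 (fun k => b1 k - a1 k) n + sum_f_R0 (fun k => b2 k - a2 k) n).
    { intros m; induction m as [|m IH].
      - change (S (2 * 0)) with 1%nat; simpl; reflexivity.
      - replace (S (2 * S m)) with (S (S (S (2 * m)))) by lia.
        rewrite 2!tech5, IH, 2!tech5.
        replace (S (S (2 * m))) with (2 * S m)%nat by lia.
        rewrite !Ev, !Od; ring. }
    rewrite E; generalize (S1 n) (S2 n); lra.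
Qed.

Lemma ae_and (P Q : R -> Prop) : ae P -> ae Q -> ae (fun x => P x /\ Q x).
Proof.
  intros (N1 & Z1 & H1) (N2 & Z2 & H2).
  exists (fun x => N1 x \/ N2 x); split; [now apply null_set_union|].
  intros x Hx; split; [apply H1 | apply H2]; tauto.
Qed.

(** * Analytic functions near the boundary of the half-plane *)

Lemma Cnorm_Cmod z : Cnorm z = Cmod z.
Proof. unfold Cnorm, Cmod; f_equal; simpl; ring. Qed.

Lemma Cnorm_pos z : 0 <= Cnorm z.
Proof. apply sqrt_pos. Qed.

Lemma Cnorm_add z w : Cnorm (Cadd z w) <= Cnorm z + Cnorm w.
Proof. rewrite !Cnorm_Cmod; apply Cmod_triangle. Qed.

Lemma Cnorm_mul z w : Cnorm (Cmul z w) = Cnorm z * Cnorm w.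
Proof. rewrite !Cnorm_Cmod; apply Cmod_mult. Qed.

Lemma Cnorm_fst z : Rabs (fst z) <= Cnorm z.
Proof.
  rewrite Cnorm_Cmod; eapply Rle_trans; [apply Rmax_l | apply Rmax_Cmod].
Qed.

Lemma Cnorm_snd z : Rabs (snd z) <= Cnorm z.
Proof.
  rewrite Cnorm_Cmod; eapply Rle_trans; [apply Rmax_r | apply Rmax_Cmod].
Qed.

Lemma Cnorm_le_sum z : Cnorm z <= Rabs (fst z) + Rabs (snd z).
Proof.
  assert (H1 := Rabs_pos (fst z)); assert (H2 := Rabs_pos (snd z)).
  apply Rsqr_incr_0_var; [|lra].
  unfold Cnorm; rewrite Rsqr_sqrt; [|nra].
  assert (E1 := Rsqr_abs (fst z)); assert (E2 := Rsqr_abs (snd z)).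
  unfold Rsqr in *; nra.
Qed.

Lemma Cx_ext (z w : Cx) : fst z = fst w -> snd z = snd w -> z = w.
Proof. destruct z, w; simpl; congruence. Qed.

(** The entire function [exp (i z)], which extends [Cexpi] from the real line. *)
Definition Cexp_i (z : Cx) : Cx :=
  (exp (- snd z) * cos (fst z), exp (- snd z) * sin (fst z)).

Lemma Cnorm_Cexp_i z : Cnorm (Cexp_i z) = exp (- snd z).
Proof.
  unfold Cnorm, Cexp_i; simpl.
  replace (exp (- snd z) * cos (fst z) * (exp (- snd z) * cos (fst z)) +
    exp (- snd z) * sin (fst z) * (exp (- snd z) * sin (fst z)))
    with (exp (- snd z) * exp (- snd z) * (Rsqr (sin (fst z)) + Rsqr (cos (fst z))))
    by (unfold Rsqr; ring).
  rewrite sin2_cos2, Rmult_1_r; apply sqrt_square; left; apply exp_pos.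
Qed.

Lemma differentiable_plus f g x y a b c d :
  differentiable_pt_lim f x y a b -> differentiable_pt_lim g x y c d ->
  differentiable_pt_lim (fun u v => f u v + g u v) x y (a + c) (b + d).
Proof.
  intros Hf Hg.
  replace (a + c) with (1 * a + 1 * c) by ring; replace (b + d) with (1 * b + 1 * d) by ring.
  apply (differentiable_pt_lim_comp (fun u v => u + v)); auto.
  intros eps; exists (mkposreal 1 Rlt_0_1); intros u v _ _.
  replace (u + v - _ - _) with 0 by ring; rewrite Rabs_R0.
  apply Rmult_le_pos; [left; apply eps|].
  eapply Rle_trans; [apply Rabs_pos | apply Rmax_l].
Qed.

Lemma differentiable_mult f g x y a b c d :
  differentiable_pt_lim f x y a b -> differentiable_pt_lim g x y c d ->
  differentiable_pt_lim (fun u v => f u v * g u v) x y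
    (g x y * a + f x y * c) (g x y * b + f x y * d).
Proof.
  intros Hf Hg.
  apply (differentiable_pt_lim_comp (fun u v => u * v)); auto.
  intros eps; exists eps; intros u v Hu Hv.
  replace (u * v - _ - _) with ((u - f x y) * (v - g x y)) by ring; rewrite Rabs_mult.
  apply Rmult_le_compat; auto using Rabs_pos; [lra | apply Rmax_r].
Qed.

Lemma differentiable_comp (phi : R -> R) l f x y a b :
  derivable_pt_lim phi (f x y) l -> differentiable_pt_lim f x y a b ->
  differentiable_pt_lim (fun u v => phi (f u v)) x y (l * a) (l * b).
Proof.
  intros Hphi Hf.
  replace (l * a) with (l * a + 0 * a) by ring; replace (l * b) with (l * b + 0 * b) by ring.
  apply (differentiable_pt_lim_comp (fun u _ => phi u) f f); auto.
  now apply differentiable_pt_lim_proj1_0.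
Qed.

Lemma differentiable_opp f x y a b :
  differentiable_pt_lim f x y a b ->
  differentiable_pt_lim (fun u v => - f u v) x y (- a) (- b).
Proof.
  intros Hf; replace (- a) with ((-1) * a) by ring; replace (- b) with ((-1) * b) by ring.
  apply (differentiable_comp (fun t => - t)); auto.
  apply (derivable_pt_lim_opp (fun t => t)), derivable_pt_lim_id.
Qed.

(** Complex differentiability with derivative [p + i q], stated through real total differentials so
    that the two-variable chain rule and [goursat] apply directly. *)
Definition cauchy_riemann (F : Cx -> Cx) (x y : R) : Prop :=
  exists p q, differentiable_pt_lim (fun u v => fst (F (u, v))) x y p (- q) /\
              differentiable_pt_lim (fun u v => snd (F (u, v))) x y q p.

Lemma differentiable_eq f x y a b a' b' :
  differentiable_pt_lim f x y a b -> a = a' -> b = b' -> differentiable_pt_lim f x y a' b'.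
Proof. now intros H <- <-. Qed.

Lemma cauchy_riemann_const (c : Cx) x y : cauchy_riemann (fun _ => c) x y.
Proof.
  exists 0, 0; rewrite Ropp_0; split;
  apply (differentiable_pt_lim_proj1_0 (fun _ => _)), derivable_pt_lim_const.
Qed.

Lemma cauchy_riemann_id x y : cauchy_riemann (fun z => z) x y.
Proof.
  exists 1, 0; rewrite Ropp_0; simpl; split.
  - apply (differentiable_pt_lim_proj1_0 (fun u => u)), derivable_pt_lim_id.
  - intros eps; exists (mkposreal 1 Rlt_0_1); intros u v _ _.
    replace (v - y - _) with 0 by ring; rewrite Rabs_R0.
    apply Rmult_le_pos; [left; apply eps|].
    eapply Rle_trans; [apply Rabs_pos | apply Rmax_l].
Qed.

Lemma cauchy_riemann_add F G x y :
  cauchy_riemann F x y -> cauchy_riemann G x y ->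
  cauchy_riemann (fun z => Cadd (F z) (G z)) x y.
Proof.
  intros (p & q & HF1 & HF2) (r & s & HG1 & HG2).
  exists (p + r), (q + s); simpl; split;
  (eapply differentiable_eq; [apply differentiable_plus; eassumption | ring | ring]).
Qed.

Lemma cauchy_riemann_mul F G x y :
  cauchy_riemann F x y -> cauchy_riemann G x y ->
  cauchy_riemann (fun z => Cmul (F z) (G z)) x y.
Proof.
  intros (p & q & HF1 & HF2) (r & s & HG1 & HG2).
  exists (fst (F (x, y)) * r - snd (F (x, y)) * s + (p * fst (G (x, y)) - q * snd (G (x, y)))),
         (fst (F (x, y)) * s + snd (F (x, y)) * r + (p * snd (G (x, y)) + q * fst (G (x, y)))).
  simpl; split.
  - eapply differentiable_eq.
    + apply differentiable_plus; [|apply differentiable_opp];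
        apply differentiable_mult; eassumption.
    + simpl; ring.
    + simpl; ring.
  - eapply differentiable_eq.
    + apply differentiable_plus; apply differentiable_mult; eassumption.
    + simpl; ring.
    + simpl; ring.
Qed.

Lemma cauchy_riemann_Cexp_i F x y :
  cauchy_riemann F x y -> cauchy_riemann (fun z => Cexp_i (F z)) x y.
Proof.
  intros (p & q & H1 & H2).
  assert (HE := differentiable_comp exp _ _ x y _ _ (derivable_pt_lim_exp _)
    (differentiable_opp _ _ _ _ _ H2)).
  assert (HC := differentiable_comp cos _ _ x y _ _ (derivable_pt_lim_cos _) H1).
  assert (HS := differentiable_comp sin _ _ x y _ _ (derivable_pt_lim_sin _) H1).
  set (e := exp (- snd (F (x, y)))) in *.
  exists (e * (- q * cos (fst (F (x, y))) - p * sin (fst (F (x, y))))),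
         (e * (p * cos (fst (F (x, y))) - q * sin (fst (F (x, y))))).
  unfold Cexp_i; simpl; split; (eapply differentiable_eq;
    [apply differentiable_mult; eassumption | simpl; fold e; ring | simpl; fold e; ring]).
Qed.

Lemma holo_cauchy_riemann F x y : holo_UHP F -> 0 < y -> cauchy_riemann F x y.
Proof.
  intros HF Hy; destruct (HF (x, y) Hy) as [[p q] HL].
  assert (K : forall eps : posreal, exists delta : posreal, forall u v,
    Rabs (u - x) < delta -> Rabs (v - y) < delta ->
    Cnorm (Csub (Csub (F (u, v)) (F (x, y))) (Cmul (p, q) (u - x, v - y))) <=
    eps * Rmax (Rabs (u - x)) (Rabs (v - y))).
  (* Halving [eps] and [d] pays for the change of norm: the modulus is at most twice the maximum
     norm used by [differentiable_pt_lim]. The zero increment, excluded in [holo_UHP], is treated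
     separately. *)
  { intros eps; destruct (HL (eps / 2)) as (d & Hd & H); [generalize (cond_pos eps); lra|].
    exists (mkposreal (d / 2) ltac:(lra)); simpl; intros u v Hu Hv.
    assert (Hn := Cnorm_le_sum (u - x, v - y)); simpl in Hn.
    assert (M1 := Rmax_l (Rabs (u - x)) (Rabs (v - y)));
    assert (M2 := Rmax_r (Rabs (u - x)) (Rabs (v - y))).
    assert (P1 := Rabs_pos (u - x)).
    assert (He := cond_pos eps).
    destruct (classic ((u - x, v - y) = (0, 0))) as [E|E].
    - injection E as E1 E2; replace u with x by lra; replace v with y by lra.
      replace (Csub _ _) with (0, 0).
      + unfold Cnorm; simpl; rewrite Rmult_0_l, Rplus_0_l, sqrt_0.
        apply Rmult_le_pos; [lra|]; eapply Rle_trans; [apply Rabs_pos | apply Rmax_l].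
      + apply Cx_ext; simpl; ring.
    - specialize (H (u - x, v - y) E ltac:(lra)).
      replace (Cadd (x, y) (u - x, v - y)) with (u, v) in H by (apply Cx_ext; simpl; ring).
      eapply Rle_trans; [exact H|].
      replace (eps * Rmax (Rabs (u - x)) (Rabs (v - y))) with
        (eps / 2 * (2 * Rmax (Rabs (u - x)) (Rabs (v - y)))) by field.
      apply Rmult_le_compat_l; lra. }
  exists p, q; split; intros eps; destruct (K eps) as [d H]; exists d; intros u v Hu Hv;
    (eapply Rle_trans; [|apply (H u v Hu Hv)]).
  - eapply Rle_trans; [|apply Cnorm_fst]; right; f_equal; simpl; ring.
  - eapply Rle_trans; [|apply Cnorm_snd]; right; f_equal; simpl; ring.
Qed.

(** * Real polynomials on horizontal strips far to the right *)

Definition cpeval (p : list R) (z : Cx) : Cx :=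
  fold_right (fun a acc => Cadd (a, 0) (Cmul z acc)) (0, 0) p.

Lemma cpeval_real p x : cpeval p (x, 0) = (peval p x, 0).
Proof.
  induction p as [|a p IH]; [reflexivity|].
  simpl; fold (cpeval p (x, 0)) (peval p x); rewrite IH; apply Cx_ext; simpl; ring.
Qed.

Lemma cauchy_riemann_cpeval p x y : cauchy_riemann (cpeval p) x y.
Proof.
  induction p as [|a p IH].
  - apply cauchy_riemann_const.
  - change (cauchy_riemann (fun z => Cadd (a, 0) (Cmul z (cpeval p z))) x y).
    apply cauchy_riemann_add; [apply cauchy_riemann_const|].
    apply cauchy_riemann_mul; [apply cauchy_riemann_id | exact IH].
Qed.

Lemma cpeval_cone p : lead p > 0 ->
  exists c, 0 < c /\ forall Y theta, 0 < Y -> 0 < theta -> exists A, forall x y,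
    A <= x -> 0 <= y <= Y ->
    c <= fst (cpeval p (x, y)) /\ 0 <= snd (cpeval p (x, y)) /\
    snd (cpeval p (x, y)) <= theta * fst (cpeval p (x, y)).
Proof.
  induction p as [|a p IH]; intros Hl; [unfold lead in Hl; simpl in Hl; lra|].
  destruct p as [|b p].
  - unfold lead in Hl; simpl in Hl.
    exists a; split; [lra|]; intros Y theta HY Ht; exists 0; intros x y Hx Hy; simpl.
    rewrite !Rmult_0_r, !Rminus_0_r, !Rplus_0_r.
    assert (0 < theta * a) by (apply Rmult_lt_0_compat; lra); lra.
  - destruct (IH Hl) as (c & Hc & H).
    exists 1; split; [lra|]; intros Y theta HY Ht.
    destruct (H Y (theta / 2) HY ltac:(lra)) as [A HA].
    (* Once the factor of the real part [S >= c] is at least [K], the product absorbs the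
       coefficient [a] and still leaves 1. *)
    set (K := (1 + Rabs a) / c).
    assert (HK0 : 0 < K).
    { apply Rdiv_lt_0_compat; [generalize (Rabs_pos a)|]; lra. }
    assert (HK : K * c = 1 + Rabs a) by (unfold K; field; lra).
    assert (HYt : 0 < Y / theta) by (apply Rdiv_lt_0_compat; lra).
    assert (HYt' : Y / theta * theta = Y) by (field; lra).
    assert (HtY : 0 < theta * Y) by (apply Rmult_lt_0_compat; lra).
    (* This threshold is exactly [x / 2 - theta * Y / 2 - Y / theta >= K], the condition behind
       [HS2]; it also implies the one behind [HS1]. *)
    exists (Rmax A (theta * Y + 2 * (Y / theta) + 2 * K)); intros x y Hx Hy.
    assert (Hx1 := Rle_trans _ _ _ (Rmax_l _ _) Hx).
    assert (Hx2 := Rle_trans _ _ _ (Rmax_r _ _) Hx).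
    destruct (HA x y Hx1 Hy) as (B1 & B2 & B3).
    change (cpeval (a :: b :: p) (x, y)) with
      (Cadd (a, 0) (Cmul (x, y) (cpeval (b :: p) (x, y)))).
    destruct (cpeval (b :: p) (x, y)) as [S T]; simpl in B1, B2, B3 |- *.
    assert (HyT : y * T <= Y * (theta / 2 * S)) by (apply Rmult_le_compat; lra).
    assert (HxT : x * T <= x * (theta / 2 * S)) by (apply Rmult_le_compat_l; lra).
    assert (HyS : y * S <= Y * S) by (apply Rmult_le_compat_r; lra).
    assert (0 <= x * T) by (apply Rmult_le_pos; lra).
    assert (0 <= y * S) by (apply Rmult_le_pos; lra).
    assert (Ha := Rabs_le_between a (Rabs a)); destruct Ha as [Ha _];
      specialize (Ha (Rle_refl _)).
    assert (HS1 : K * c <= (x - theta * Y / 2) * S) by (apply Rmult_le_compat; lra).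
    assert (HS2 : K * c <= (x / 2 - theta * Y / 2 - Y / theta) * S)
      by (apply Rmult_le_compat; lra).
    repeat split; try lra.
    apply Rle_trans with (theta * ((x / 2 + Y / theta) * S)).
    + replace (theta * ((x / 2 + Y / theta) * S)) with
        (x * (theta / 2 * S) + (Y / theta * theta) * S) by (field; lra).
      rewrite HYt'; lra.
    + apply Rmult_le_compat_l; [lra|]; nra.
Qed.

(** The imaginary part of [a + z * p(z)] is [x * Im p(z) + y * Re p(z)]; the sector estimate makes
    the first term nonnegative and the second at least [c * y]. *)
Lemma cpeval_imaginary_part a p : lead p > 0 ->
  exists c, 0 < c /\ forall Y, 0 < Y -> exists A, forall x y,
    A <= x -> 0 <= y <= Y -> c * y <= snd (cpeval (a :: p) (x, y)).
Proof.
  intros Hl; destruct (cpeval_cone p Hl) as (c & Hc & H).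
  exists c; split; auto; intros Y HY.
  destruct (H Y 1 HY Rlt_0_1) as [A HA].
  exists (Rmax A 0); intros x y Hx Hy.
  assert (Hx1 := Rle_trans _ _ _ (Rmax_l _ _) Hx).
  assert (Hx2 := Rle_trans _ _ _ (Rmax_r _ _) Hx).
  destruct (HA x y Hx1 Hy) as (B1 & B2 & _).
  change (cpeval (a :: p) (x, y)) with (Cadd (a, 0) (Cmul (x, y) (cpeval p (x, y)))).
  simpl.
  assert (0 <= x * snd (cpeval p (x, y))) by (apply Rmult_le_pos; lra).
  assert (c * y <= fst (cpeval p (x, y)) * y) by (apply Rmult_le_compat_r; lra).
  lra.
Qed.

(** * The contour argument *)

Lemma decaying_boundary_not_one (G : Cx -> Cx) (M c A0 : R) (N : R -> Prop) :
  0 < M -> 0 < c ->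
  (forall x y, 0 < y -> cauchy_riemann G x y) ->
  (forall Y, 0 < Y -> exists A, forall x y, A <= x -> 0 < y <= Y ->
     Cnorm (G (x, y)) <= M * exp (- (c * y))) ->
  null_set N ->
  (forall x, A0 <= x -> ~ N x ->
     exists d, 0 < d /\ forall y, 0 < y < d -> Cnorm (Csub (G (x, y)) (1, 0)) < 1 / 4) ->
  False.
Proof.
  intros HM Hc HG Hdec HN Hbv.
  (* With [c * Y = 8 * M], the inequality [exp t >= 1 + t] gives [M * exp (- (c * Y)) <= M / (1 + 8
     * M) < 1 / 8]. *)
  set (Y := 8 * M / c).
  assert (HY : 0 < Y) by (apply Rdiv_lt_0_compat; lra).
  assert (HMY : 0 < M * Y) by (apply Rmult_lt_0_compat; lra).
  assert (Htop : M * exp (- (c * Y)) <= 1 / 8).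
  { assert (E : c * Y = 8 * M) by (unfold Y; field; lra).
    rewrite E, exp_Ropp.
    assert (Hexp := exp_ineq1_le (8 * M)).
    apply Rmult_le_reg_r with (exp (8 * M)); [apply exp_pos|].
    rewrite Rmult_assoc, Rinv_l by (generalize (exp_pos (8 * M)); lra); lra. }
  destruct (Hdec Y HY) as [A1 HA1].
  set (A := Rmax A0 A1); assert (HA0 := Rmax_l A0 A1); assert (HA1' := Rmax_r A0 A1).
  fold A in HA0, HA1'.
  (* The two vertical sides contribute at most [2 * M * Y = T / 8], as much as is allowed to the
     top. *)
  set (T := 16 * (M * Y)).
  assert (HT : 0 < T) by (unfold T; lra).
  assert (HGM : forall x y, A <= x -> 0 < y <= Y -> Cnorm (G (x, y)) <= M).
  { intros x y Hx Hy; eapply Rle_trans; [apply HA1; lra|].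
    rewrite <- (Rmult_1_r M) at 2; apply Rmult_le_compat_l; [lra|].
    rewrite <- exp_0.
    assert (0 <= c * y) by (apply Rmult_le_pos; lra).
    destruct (Req_dec (c * y) 0) as [E|E]; [rewrite E, Ropp_0; lra|].
    left; apply exp_increasing; lra. }
  pose (U := fun x y => fst (G (x, y))); pose (V := fun x y => snd (G (x, y))).
  assert (CU : forall x y, 0 < y -> continuous (fun t => U t y) x).
  { intros x y Hy; destruct (HG x y Hy) as (p & q & H1 & _).
    exact (differentiable_continuous_fst U x y p (- q) H1). }
  assert (CV : forall x y, 0 < y -> continuous (fun t => V x t) y).
  { intros x y Hy; destruct (HG x y Hy) as (p & q & _ & H2).
    exact (differentiable_continuous_snd V x y q p H2). }
  assert (Hlow : forall eta, 0 < eta < Y -> RInt (fun x => U x eta) A (A + T) <= T / 4).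
  { intros eta Heta.
    assert (HC : circulation U V A (A + T) eta (eta + (Y - eta)) = 0).
    { apply goursat; try lra; intros x y Hx Hy.
      destruct (HG x y ltac:(lra)) as (p & q & H1 & H2).
      exists p, (- q), p; rewrite Ropp_involutive; split; assumption. }
    replace (eta + (Y - eta)) with Y in HC by ring; unfold circulation in HC.
    assert (B1 : RInt (fun x => U x Y) A (A + T) <= 1 / 8 * (A + T - A)).
    { apply RInt_le_const; [lra | intros; apply CU; lra |]; intros x Hx.
      eapply Rle_trans; [apply Rle_abs|]; eapply Rle_trans; [apply Cnorm_fst|].
      eapply Rle_trans; [apply HA1; lra | exact Htop]. }
    assert (BV : forall x, A <= x -> Rabs (RInt (fun y => V x y) eta Y) <= (Y - eta) * M).
    { intros x Hx; apply abs_RInt_le_const; [lra | |].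
      - apply ex_RInt_cont; [lra|]; intros; apply CV; lra.
      - intros y Hy; eapply Rle_trans; [apply Cnorm_snd | apply HGM; lra]. }
    assert (B2 := BV (A + T) ltac:(lra)); assert (B3 := BV A ltac:(lra)).
    apply Rabs_le_between in B2; apply Rabs_le_between in B3.
    assert (0 < eta * M) by (apply Rmult_lt_0_compat; lra).
    unfold T in *; lra. }
  (* The shift by 2 keeps [eta n] strictly below [Y] even at [n = 0]. *)
  pose (eta := fun n => Y / (INR n + 2)).
  assert (Heta : forall n, 0 < eta n < Y).
  { intros n; assert (Hn := pos_INR n); unfold eta; split; [apply Rdiv_lt_0_compat; lra|].
    apply Rmult_lt_reg_r with (INR n + 2); [lra|].
    unfold Rdiv; rewrite Rmult_assoc, Rinv_l by lra.
    assert (0 <= Y * INR n) by (apply Rmult_le_pos; lra); lra. }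
  (* Some lower side then has integral at least [T - T / 4 - T / 8 = 5 T / 8], against the bound
     [T / 4] in [Hlow]. *)
  destruct (bounded_convergence_null (fun n x => 1 - U x (eta n)) A (A + T) (1 + M) (1 / 4)
    (T / 8) N) as [n Hn]; try lra; auto.
  - intros n x; apply (continuous_minus (V := R_NormedModule) (fun _ => 1) (fun t => U t (eta n))).
    + apply continuous_const.
    + apply CU, Heta.
  - intros n x Hx.
    assert (H := HGM x (eta n) ltac:(lra) ltac:(generalize (Heta n); lra)).
    assert (H' := Rle_trans _ _ _ (Cnorm_fst _) H).
    apply Rabs_le_between in H'; unfold U; lra.
  - intros x Hx NX; destruct (Hbv x ltac:(lra) NX) as (d & Hd & Hy).
    destruct (INR_unbounded (Y / d)) as [n Hn].
    exists n; intros m Hm.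
    assert (Hnm := le_INR _ _ Hm).
    assert (Hetam : eta m < d).
    { unfold eta; assert (Hp := pos_INR m).
      apply Rmult_lt_reg_r with (INR m + 2); [lra|].
      unfold Rdiv; rewrite Rmult_assoc, Rinv_l by lra.
      apply Rmult_lt_compat_r with (r := d) in Hn; [|lra].
      unfold Rdiv in Hn; rewrite Rmult_assoc, Rinv_l in Hn by lra.
      assert (INR n * d <= INR m * d) by (apply Rmult_le_compat_r; lra); lra. }
    assert (H := Hy (eta m) ltac:(generalize (Heta m); lra)).
    assert (H' := Rle_lt_trans _ _ _ (Cnorm_fst _) H); simpl in H'.
    apply Rabs_lt_between in H'; unfold U; lra.
  - assert (E : RInt (fun x => 1 - U x (eta n)) A (A + T) =
                T - RInt (fun x => U x (eta n)) A (A + T)).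
    { apply is_RInt_unique.
      replace (T - RInt (fun x => U x (eta n)) A (A + T)) with
        (scal (A + T - A) 1 - RInt (fun x => U x (eta n)) A (A + T))
        by (unfold scal; simpl; unfold mult; simpl; ring).
      apply (is_RInt_minus (V := R_NormedModule) (fun _ => 1)).
      - apply (is_RInt_const (V := R_NormedModule)).
      - apply (RInt_correct (V := R_CompleteNormedModule)), ex_RInt_cont; [lra|].
        intros; apply CU, Heta. }
    cbv beta in Hn; rewrite E in Hn; generalize (Hlow (eta n) (Heta n)); lra.
Qed.

(** Convertible with the boundary clause of [Hinf], so that vertical limits of [F1] and [F2] can be
    used as they are. *)
Definition cx_limit_0 (f : R -> Cx) (l : Cx) : Prop :=
  forall eps, eps > 0 -> exists d, d > 0 /\ forall y, 0 < y < d -> Cnorm (Csub (f y) l) < eps.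

Lemma cx_limit_0_add_const f l c : cx_limit_0 f l -> cx_limit_0 (fun y => Cadd (f y) c) (Cadd l c).
Proof.
  intros H eps He; destruct (H eps He) as (d & Hd & H'); exists d; split; auto.
  intros y Hy; replace (Csub _ _) with (Csub (f y) l) by (apply Cx_ext; simpl; ring); auto.
Qed.

Lemma cx_limit_0_mul f g l m : cx_limit_0 f l -> cx_limit_0 g m -> cx_limit_0 (fun y => Cmul (f y) (g y)) (Cmul l m).
Proof.
  intros Hf Hg eps He.
  assert (Pl := Cnorm_pos l); assert (Pm := Cnorm_pos m).
  set (B := Cnorm l + Cnorm m + 1).
  set (e := Rmin 1 (eps / (2 * B))).
  assert (HB : 0 < eps / (2 * B)) by (apply Rdiv_lt_0_compat; unfold B; lra).
  assert (He0 : 0 < e) by (apply Rmin_glb_lt; lra).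
  assert (He1 : e <= 1) by apply Rmin_l.
  assert (HeB : e * B <= eps / 2).
  { replace (eps / 2) with (eps / (2 * B) * B) by (field; unfold B; lra).
    apply Rmult_le_compat_r; [unfold B; lra | apply Rmin_r]. }
  destruct (Hf e He0) as (d1 & Hd1 & H1); destruct (Hg e He0) as (d2 & Hd2 & H2).
  exists (Rmin d1 d2); split; [apply Rmin_glb_lt; lra|]; intros y Hy.
  assert (L1 := Rmin_l d1 d2); assert (L2 := Rmin_r d1 d2).
  specialize (H1 y ltac:(lra)); specialize (H2 y ltac:(lra)).
  replace (Csub (Cmul (f y) (g y)) (Cmul l m)) with
    (Cadd (Cmul (Csub (f y) l) (Cadd (Csub (g y) m) m)) (Cmul l (Csub (g y) m)))
    by (apply Cx_ext; simpl; ring).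
  eapply Rle_lt_trans; [apply Cnorm_add|]; rewrite !Cnorm_mul.
  assert (N := Cnorm_add (Csub (g y) m) m).
  assert (Cnorm (Csub (f y) l) * Cnorm (Cadd (Csub (g y) m) m) <= e * (1 + Cnorm m))
    by (apply Rmult_le_compat; auto using Cnorm_pos; lra).
  assert (Cnorm l * Cnorm (Csub (g y) m) <= Cnorm l * e)
    by (apply Rmult_le_compat_l; lra).
  unfold B in HeB; lra.
Qed.

Lemma cx_limit_0_cauchy_riemann F x : cauchy_riemann F x 0 -> cx_limit_0 (fun y => F (x, y)) (F (x, 0)).
Proof.
  intros (p & q & H1 & H2) eps He.
  apply differentiable_continuous_snd in H1; apply differentiable_continuous_snd in H2.
  apply continuity_pt_filterlim in H1; apply continuity_pt_filterlim in H2.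
  destruct (H1 (eps / 2) ltac:(lra)) as (d1 & Hd1 & K1).
  destruct (H2 (eps / 2) ltac:(lra)) as (d2 & Hd2 & K2).
  exists (Rmin d1 d2); split; [apply Rmin_glb_lt; lra|]; intros y Hy.
  assert (L1 := Rmin_l d1 d2); assert (L2 := Rmin_r d1 d2).
  assert (HD : forall d, y < d -> D_x no_cond 0 y /\ Rabs (y - 0) < d).
  { intros d Hyd; split; [split; [exact I | lra] | apply Rabs_lt_between; lra]. }
  specialize (K1 y (HD d1 ltac:(lra))); specialize (K2 y (HD d2 ltac:(lra))).
  simpl in K1, K2; unfold R_dist in K1, K2.
  eapply Rle_lt_trans; [apply Cnorm_le_sum|]; simpl; lra.
Qed.

Theorem theorem5p4 (u : R -> Cx) (p : list R) :
  HinfC u ->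
  ae (fun x => Cnorm (u x) = 1) ->
  lead p > 0 ->
  (forall x, peval p (- x) = - peval p x) ->
  ~ HinfC (fun x => Cmul (Cexpi (- peval p x)) (Cconj (u x))).
Proof.
  intros (h1 & g1 & (F1 & HF1 & [M1 HM1] & B1) & [_ [L1 [HL1 _]]] & E1) Hu Hlead Hodd
         (h2 & g2 & (F2 & HF2 & [M2 HM2] & B2) & [_ [L2 [HL2 _]]] & E2).
  destruct p as [|a p]; [unfold lead in Hlead; simpl in Hlead; lra|].
  assert (Hlead' : lead p > 0).
  (* Oddness at 0 forces the constant term to vanish, so a constant polynomial cannot have positive
     leading coefficient; hence [p = a + x * p1] with [lead p1 > 0]. *)
  { destruct p as [|b p]; [|exact Hlead].
    specialize (Hodd 0); unfold lead in Hlead; simpl in Hlead, Hodd; lra. }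
  clear Hlead Hodd.
  destruct (cpeval_imaginary_part a p Hlead') as (c & Hc & Hgrow); clear Hlead'.
  set (q := a :: p) in *; clearbody q.
  destruct (ae_and _ _ (ae_and _ _ E1 E2) (ae_and _ _ Hu (ae_and _ _ B1 B2)))
    as (N & HN & Hae).
  (* Two errors of [1 / 32] change the product by at most [1 / 32 * (1 + 1 / 32) + 1 / 32 < 1 / 8],
     half of the tolerance [1 / 4]; the other half is for the vertical limit. *)
  destruct (HL1 (1 / 32) ltac:(lra)) as [A1 HA1].
  destruct (HL2 (1 / 32) ltac:(lra)) as [A2 HA2].
  pose (G := fun z => Cmul (Cmul (Cadd (F1 z) L1) (Cadd (F2 z) L2)) (Cexp_i (cpeval q z))).
  set (K1 := M1 + Cnorm L1); set (K2 := M2 + Cnorm L2).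
  assert (HK1 : forall z, 0 < snd z -> Cnorm (Cadd (F1 z) L1) <= K1).
  { intros z Hz; eapply Rle_trans; [apply Cnorm_add|]; unfold K1; generalize (HM1 z Hz); lra. }
  assert (HK2 : forall z, 0 < snd z -> Cnorm (Cadd (F2 z) L2) <= K2).
  { intros z Hz; eapply Rle_trans; [apply Cnorm_add|]; unfold K2; generalize (HM2 z Hz); lra. }
  assert (PK1 : 0 <= K1).
  { eapply Rle_trans; [|apply (HK1 (0, 1)); simpl; lra]; apply Cnorm_pos. }
  assert (PK2 : 0 <= K2).
  { eapply Rle_trans; [|apply (HK2 (0, 1)); simpl; lra]; apply Cnorm_pos. }
  assert (PK : 0 <= K1 * K2) by (apply Rmult_le_pos; lra).
  (* The first [+ 1] makes the bound positive; the second turns [A0 <= x] into the strict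
     inequalities that [HA1] and [HA2] require. *)
  apply (decaying_boundary_not_one G (K1 * K2 + 1) c (Rmax A1 A2 + 1) N); auto; try lra.
  - intros x y Hy; unfold G.
    apply cauchy_riemann_mul; [apply cauchy_riemann_mul|].
    + apply cauchy_riemann_add; [now apply holo_cauchy_riemann | apply cauchy_riemann_const].
    + apply cauchy_riemann_add; [now apply holo_cauchy_riemann | apply cauchy_riemann_const].
    + apply cauchy_riemann_Cexp_i, cauchy_riemann_cpeval.
  - intros Y HY; destruct (Hgrow Y HY) as [A HA]; exists A; intros x y Hx Hy.
    unfold G; rewrite !Cnorm_mul, Cnorm_Cexp_i.
    apply Rmult_le_compat; auto using Rmult_le_pos, Cnorm_pos.
    + left; apply exp_pos.
    + apply Rle_trans with (K1 * K2); [|lra].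
      apply Rmult_le_compat; auto using Cnorm_pos; [apply HK1 | apply HK2]; simpl; lra.
    + specialize (HA x y Hx ltac:(lra)).
      destruct HA as [HA|HA]; [left; apply exp_increasing; lra | rewrite HA; lra].
  - intros x Hx NX; destruct (Hae x NX) as [[e1 e2] [eu [b1 b2]]].
    assert (Hx1 := Rmax_l A1 A2); assert (Hx2 := Rmax_r A1 A2).
    specialize (HA1 x ltac:(lra)); specialize (HA2 x ltac:(lra)).
    set (v := Cmul (Cexpi (- peval q x)) (Cconj (u x))) in *.
    assert (ev : Cnorm v = 1).
    { unfold v; rewrite Cnorm_mul.
      replace (Cnorm (Cconj (u x))) with (Cnorm (u x)) by (unfold Cnorm; simpl; f_equal; ring).
      rewrite eu, Rmult_1_r; unfold Cnorm, Cexpi; simpl.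
      replace (_ + _) with 1; [apply sqrt_1|].
      rewrite <- (sin2_cos2 (- peval q x)); unfold Rsqr; ring. }
    set (E := Cexp_i (cpeval q (x, 0))).
    assert (HE : Cnorm E = 1).
    { unfold E; rewrite Cnorm_Cexp_i, cpeval_real; simpl; rewrite Ropp_0; apply exp_0. }
    (* The phases [exp (-i p)] in [v] and [exp (i p)] in [E] cancel, leaving the squared modulus of
       [u x]. *)
    assert (Huv : Cmul (Cmul (u x) v) E = (1, 0)).
    { assert (U2 : fst (u x) * fst (u x) + snd (u x) * snd (u x) = 1).
      { rewrite <- (Rmult_1_r 1), <- eu; unfold Cnorm; rewrite sqrt_sqrt; [reflexivity|nra]. }
      unfold E, v; rewrite cpeval_real; unfold Cexp_i, Cexpi, Cconj, Cmul; simpl.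
      rewrite Ropp_0, exp_0, cos_neg, sin_neg.
      assert (T := sin2_cos2 (peval q x)); unfold Rsqr in T.
      set (s := sin (peval q x)) in *; set (k := cos (peval q x)) in *.
      set (u1 := fst (u x)) in *; set (u2 := snd (u x)) in *.
      apply Cx_ext; simpl; [|ring].
      transitivity ((s * s + k * k) * (u1 * u1 + u2 * u2)); [ring | rewrite T, U2; ring]. }
    set (H1 := Cadd (h1 x) L1); set (H2 := Cadd (h2 x) L2).
    assert (D1 : Cnorm (Csub H1 (u x)) < 1 / 32).
    { rewrite e1; replace (Csub H1 _) with (Cmul (-1, 0) (Csub (g1 x) L1))
        by (apply Cx_ext; simpl; ring).
      rewrite Cnorm_mul; replace (Cnorm (-1, 0)) with 1; [lra|].
      unfold Cnorm; simpl; replace (_ + _) with 1 by ring; now rewrite sqrt_1. }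
    assert (D2 : Cnorm (Csub H2 v) < 1 / 32).
    { rewrite e2; replace (Csub H2 _) with (Cmul (-1, 0) (Csub (g2 x) L2))
        by (apply Cx_ext; simpl; ring).
      rewrite Cnorm_mul; replace (Cnorm (-1, 0)) with 1; [lra|].
      unfold Cnorm; simpl; replace (_ + _) with 1 by ring; now rewrite sqrt_1. }
    assert (D : Cnorm (Csub (Cmul (Cmul H1 H2) E) (1, 0)) < 1 / 8).
    { rewrite <- Huv.
      (* The identity [H1 H2 - u v = (H1 - u) H2 + u (H2 - v)], with [H2] written as [(H2 - v) + v]
         so that its modulus is visibly at most [1 + 1 / 32]. *)
      replace (Csub _ _) with (Cmul (Cadd (Cmul (Csub H1 (u x)) (Cadd (Csub H2 v) v))
        (Cmul (u x) (Csub H2 v))) E) by (apply Cx_ext; simpl; ring).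
      rewrite Cnorm_mul, HE, Rmult_1_r.
      eapply Rle_lt_trans; [apply Cnorm_add|]; rewrite !Cnorm_mul, eu.
      assert (T := Cnorm_add (Csub H2 v) v).
      assert (Cnorm (Csub H1 (u x)) * Cnorm (Cadd (Csub H2 v) v) <= 1 / 32 * (1 + 1 / 32))
        by (apply Rmult_le_compat; auto using Cnorm_pos; lra).
      lra. }
    assert (HG : cx_limit_0 (fun y => G (x, y)) (Cmul (Cmul H1 H2) E)).
    { apply cx_limit_0_mul; [apply cx_limit_0_mul; apply cx_limit_0_add_const; assumption|].
      (* The exponential factor is entire, so its vertical limit is its value on the real axis. *)
      apply (cx_limit_0_cauchy_riemann (fun z => Cexp_i (cpeval q z))).
      apply cauchy_riemann_Cexp_i, cauchy_riemann_cpeval. }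
    destruct (HG (1 / 8) ltac:(lra)) as (d & Hd & Hy); exists d; split; auto.
    intros y Hyd.
    replace (Csub (G (x, y)) (1, 0)) with
      (Cadd (Csub (G (x, y)) (Cmul (Cmul H1 H2) E)) (Csub (Cmul (Cmul H1 H2) E) (1, 0)))
      by (apply Cx_ext; simpl; ring).
    eapply Rle_lt_trans; [apply Cnorm_add|]; generalize (Hy y Hyd); lra.
Qed.
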